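(* Let $(X,d_X)$ be a nonempty ultrametric space and let $(Y,d_Y)$ be a nonempty semimetric space. If $X$ and $Y$ are weak equivalent, $D(X)=D(Y)$, and $X$ is compact, then $X$ and $Y$ are isometric.
   Context: A semimetric on a set $X$ is a function $d:X\times X\to[0,\infty)$ with $d(x,y)=d(y,x)$ and $(d(x,y)=0\Leftrightarrow x=y)$ for all $x,y\in X$; $(X,d)$ is then a semimetric space. An ultrametric is a semimetric with $d(x,y)\leqslant\max\{d(x,z),d(z,y)\}$ for all $x,y,z$. The distance set of a nonempty semimetric space is $D(X)=\{d(x,y):x,y\in X\}$. A surjective mapping $\Phi:X\to Y$ between nonempty semimetric spaces is a weak similarity if there is a strictly increasing function $f:D(Y)\to D(X)$ (a scaling function of $\Phi$) such that $d_X(x,y)=f(d_Y(\Phi(x),\Phi(y)))$ for all $x,y\in X$. $X$ and $Y$ are weak equivalent if there is a weak similarity $\Phi:X\to Y$. Semimetric spaces $X$ and $Y$ are isometric if there is a bijection $F:X\to Y$ with $d_Y(F(x),F(y))=d_X(x,y)$ for all $x,y\in X$. Compactness of $X$ refers to the topology induced by the ultrametric $d_X$. *)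

(* Defs.v *)
From HB Require Import structures.
From mathcomp Require Import all_boot all_order all_algebra.
From mathcomp Require Import all_classical all_reals all_analysis.

Set Implicit Arguments.
Unset Strict Implicit.
Unset Printing Implicit Defensive.
Import Order.TTheory GRing.Theory Num.Theory.
Local Open Scope classical_set_scope.
Local Open Scope ring_scope.

Record semimetric (R : realType) (T : Type) := Semimetric {
  sdist :> T -> T -> R ;
  sdist_ge0 : forall x y, 0 <= sdist x y ;
  sdist_sym : forall x y, sdist x y = sdist y x ;
  sdist_eq0 : forall x y, sdist x y = 0 <-> x = y
}.

Record ultrametric (R : realType) (T : Type) := Ultrametric {
  ultra_semimetric :> semimetric R T ;
  ultra_ineq : forall x y z,
    ultra_semimetric x y <=
      Num.max (ultra_semimetric x z) (ultra_semimetric z y)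
}.

(* A copy of [T] carrying the metric [d], hence the topology induced by [d]:
   [ball x e] is [set y | d x y < e]. The decidable equality and choice
   structures that [metricType] requires come from the classical axioms. *)
Definition ultrametric_space (R : realType) (T : Type) (d : ultrametric R T)
  : Type := T.

Section ultrametric_topology.
Variables (R : realType) (T : Type) (d : ultrametric R T).
Local Notation M := (ultrametric_space d).

HB.instance Definition _ := gen_eqMixin M.
HB.instance Definition _ := gen_choiceMixin M.

Let udist (x y : M) : R := d x y.

Let udistxx (x : M) : udist x x = 0.
Proof. exact/sdist_eq0. Qed.

Let udist_positivity (x y : M) : udist x y = 0 -> x = y.
Proof. by move/sdist_eq0. Qed.

Let udist_sym (x y : M) : udist x y = udist y x.
Proof. exact: sdist_sym. Qed.

Let udist_triangle (y x z : M) : udist x z <= udist x y + udist y z.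
Proof.
apply: (le_trans (ultra_ineq d x z y)).
by rewrite ge_max lerDl lerDr !sdist_ge0.
Qed.

HB.instance Definition _ := @isMetric.Build R M
  udist udistxx udist_positivity udist_sym udist_triangle.

Lemma ultrametric_ballE (x : M) (e : R) : ball x e = [set y : M | d x y < e].
Proof. by rewrite ballEmdist. Qed.

End ultrametric_topology.

Definition distance_set (R : realType) (T : Type) (d : semimetric R T) :
    set R :=
  [set r | exists x y, r = d x y].

(* The scaling function D(Y) -> D(X) is represented by a function on R of which
   only the values on D(Y) matter. *)
Definition scaling_function (R : realType) (X Y : Type) (dX : semimetric R X)
    (dY : semimetric R Y) (Phi : X -> Y) (f : R -> R) : Prop :=
  [/\ set_fun (distance_set dY) (distance_set dX) f,
      {in distance_set dY &, {homo f : s t / s < t}} &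
      forall x y, dX x y = f (dY (Phi x) (Phi y))].

Definition weak_similarity (R : realType) (X Y : Type) (dX : semimetric R X)
    (dY : semimetric R Y) (Phi : X -> Y) : Prop :=
  set_surj [set: X] [set: Y] Phi /\
  exists f : R -> R, scaling_function dX dY Phi f.

Definition weak_equivalent (R : realType) (X Y : Type) (dX : semimetric R X)
    (dY : semimetric R Y) : Prop :=
  exists Phi : X -> Y, weak_similarity dX dY Phi.

Definition isometric (R : realType) (X Y : Type) (dX : semimetric R X)
    (dY : semimetric R Y) : Prop :=
  exists F : X -> Y, bijective F /\ forall x y, dY (F x) (F y) = dX x y.

(* Main.v *)
(** A compact ultrametric space is covered by finitely many balls of radius [e],
    and a distance at least [e] is unchanged when both points are replaced by the
    centers of their balls; hence only finitely many distances are at least [e].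
    A scaling function is then a strictly increasing bijection of
    [D(X) = D(Y)] fixing [0], and it must be the identity: the largest distance
    moved up would be mapped to a larger one that is also moved up, and the
    largest distance moved down would be the image of a larger one that is also
    moved down.  So the weak similarity is an isometry. *)

From HB Require Import structures.
Require Import Defs.
From mathcomp Require Import all_boot all_order all_algebra.
From mathcomp Require Import finmap.
From mathcomp Require Import all_classical all_reals all_analysis.
Local Open Scope classical_set_scope.

Import Order.TTheory GRing.Theory Num.Theory.
Local Open Scope ring_scope.

Lemma finite_set_has_maximum {d : Order.disp_t} {T : orderType d} {A : set T} :
  finite_set A -> A !=set0 ->
  exists2 m, A m & forall t, A t -> (t <= m)%O.
Proof.
move=> /finite_fsetP[S ->] [x xS].
case: (@Order.TotalTheory.arg_maxP _ _ _ [` xS]%fset xpredT val) => // m _ mmax.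
exists (val m); first exact: valP.
by move=> t tS; exact: (mmax ([` tS]%fset)).
Qed.

Lemma strictly_increasing_bijection_id (R : realType) (D : set R) (f : R -> R) :
  (forall r, D r -> 0 <= r) ->
  (forall e, 0 < e -> finite_set (D `&` [set r | e <= r])) ->
  set_fun D D f -> set_surj D D f ->
  {in D &, {homo f : s t / s < t}} -> D 0 -> f 0 = 0 ->
  forall s, D s -> f s = s.
Proof.
move=> D_ge0 Dfin fD fsurj fmono D0 f0 s Ds.
have [->//|s_neq0] := eqVneq s 0.
have s_gt0 : 0 < s by rewrite lt_neqAle eq_sym s_neq0 D_ge0.
have mono t u : D t -> D u -> t < u -> f t < f u.
  by move=> Dt Du; apply: fmono; rewrite inE.
have monoV t u : D t -> D u -> f t < f u -> t < u.
  move=> Dt Du; rewrite !ltNge; apply: contra; rewrite le_eqVlt.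
  by case/predU1P => [->//|/(mono _ _ Du Dt)/ltW].
have finsub (P : set R) e : 0 < e ->
    finite_set (D `&` [set r | e <= r] `&` P).
  by move=> /Dfin; apply: sub_finite_set => ? [].
case: (ltgtP (f s) s) => // [fs_lt|fs_gt].
(* As [f 0 = 0], the threshold [f s] is positive, so only finitely many elements of [D] lie at or
   above it; [f s] is one that is moved down, by monotonicity. *)
- have fs_gt0 : 0 < f s by rewrite -f0; exact: mono.
  have [|m [[Dm fsm] /= fmm] mmax] :=
    finite_set_has_maximum (finsub [set r | f r < r] _ fs_gt0).
    exists (f s); do !split => //=; first exact: fD.
    by apply: mono => //; exact: fD.
  (* Here [f m < m = f u] puts [u] above [m], and [u] is moved down as well. *)
  have [u Du fum] := fsurj _ Dm.
  have mu : m < u by apply: monoV => //; rewrite fum.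
  suff : u <= m by rewrite leNgt mu.
  apply: mmax; do !split => //=; last by rewrite fum.
  exact: le_trans (ltW mu).
- have [|m [[Dm sm] /= mfm] mmax] :=
    finite_set_has_maximum (finsub [set r | r < f r] _ s_gt0).
    by exists s; do !split => //=.
  suff : f m <= m by rewrite leNgt mfm.
  apply: mmax; do !split => /=; first exact: fD.
  + exact: le_trans (ltW mfm).
  + by apply: mono => //; exact: fD.
Qed.

(** The two longest sides of an ultrametric triangle are equal, and [d z x] is too short to be one
    of them. *)
Lemma ultrametric_replace {R : realType} {T : Type} {d : ultrametric R T} {e x y z} :
  d z x < e -> e <= d x y -> d z y = d x y.
Proof.
move=> zx exy; have zxy := lt_le_trans zx exy.
apply/eqP; rewrite eq_le; apply/andP; split.
  by apply: le_trans (ultra_ineq d z y x) _; rewrite ge_max (ltW zxy) lexx.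
have := ultra_ineq d x y z; rewrite le_max => /orP[|//].
by rewrite [d x z]sdist_sym leNgt zxy.
Qed.

Lemma ultrametric_compact_finite_dist (R : realType) (T : Type)
    (d : ultrametric R T) (e : R) :
  compact [set: ultrametric_space d] -> 0 < e ->
  finite_set (distance_set d `&` [set r | e <= r]).
Proof.
move=> Tcompact e_gt0.
have [[x0]|T_empty] := pselect (inhabited T); last first.
  rewrite (_ : _ `&` _ = set0); first exact: finite_set0.
  by apply/seteqP; split => // r [[x _] _]; apply: T_empty.
pose M : ptopologicalType := HB.pack (ultrametric_space d)
  (isPointed.Build (ultrametric_space d) x0).
have : cover_compact [set: M] by rewrite -compact_cover.
(* Interiors make the cover open; each still contains its center and lies in its ball. *)
move=> /(_ M setT (fun x => (@ball R (ultrametric_space d) x e)°)).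
case=> [x _|x _|C _ Ccover].
- exact: open_interior.
- by exists x => //; exact: nbhsx_ballx.
have center x : exists2 c, c \in C & d c x < e.
  have [c cC /interior_subset] := Ccover x I.
  by rewrite ultrametric_ballE; exists c.
apply: (@sub_finite_set _ _ [set d x y | x in [set` C] & y in [set` C]]).
  move=> r [[x [y ->]] /= exy].
  have [[a aC ax] [b bC yb]] := (center x, center y).
  exists a => //; exists b => //.
  (* Moving [x] to [a] keeps the distance at least [e], so [y] can then be moved to [b]. *)
  have ay : d a y = d x y by exact: ultrametric_replace ax exy.
  have eya : e <= d y a by rewrite sdist_sym ay.
  by rewrite sdist_sym (ultrametric_replace yb eya) sdist_sym.
by apply: finite_image2; exact: finite_fset.
Qed.

Theorem theorem3p1 (R : realType) (X Y : Type)
    (dX : ultrametric R X) (dY : semimetric R Y)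
    (X_nonempty : inhabited X) (Y_nonempty : inhabited Y) :
  weak_equivalent dX dY ->
  distance_set dX = distance_set dY ->
  compact [set: ultrametric_space dX] ->
  isometric dX dY.
Proof.
move=> [Phi [Phi_surj [f [fD fmono dXE]]]] DXY Xcompact.
have d0 (T : Type) (d : semimetric R T) x : d x x = 0 by exact/sdist_eq0.
have [x0] := X_nonempty.
have fid r : distance_set dX r -> f r = r.
  apply: (@strictly_increasing_bijection_id R (distance_set dX) f).
  - by move=> _ [x [y ->]]; exact: sdist_ge0.
  - by move=> e; exact: ultrametric_compact_finite_dist.
  - by rewrite {1}DXY.
  (* Every distance in [X] is a value of [f] by the scaling identity, so [f] is onto. *)
  - move=> _ [x [y ->]]; exists (dY (Phi x) (Phi y)); last by rewrite dXE.
    by rewrite DXY; exists (Phi x), (Phi y).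
  - by rewrite DXY.
  - by exists x0, x0; rewrite d0.
  - by rewrite -(d0 _ dY (Phi x0)) -dXE !d0.
have Phi_isom x y : dY (Phi x) (Phi y) = dX x y.
  by rewrite dXE fid // DXY; exists (Phi x), (Phi y).
exists Phi; split => //.
have section_ y : exists x, Phi x = y by have [x _ <-] := Phi_surj y I; exists x.
have [G GK] := choice section_.
(* The section [G] is also a left inverse: [G (Phi x)] and [x] have the same image, hence distance
   0. *)
exists G => // x; apply/(sdist_eq0 dX); rewrite -Phi_isom GK; exact/sdist_eq0.
Qed.
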